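(* Let $n\geq 4$ be an integer and let $\alpha,\beta>-1$ be real numbers. Let $x_{1n}(\alpha,\beta)$ denote the smallest zero of the Jacobi polynomial $P_n^{(\alpha,\beta)}$. Then $$1+x_{1n}(\alpha,\beta)<\frac{4(\beta+1)(\beta+2)(\beta+4)}{(5\beta+11)\big[n(n+\alpha+\beta+1)+\frac{1}{3}(\alpha+1)(\beta+1)\big]}.$$ Moreover, if either $n\geq\max\{4,\alpha+\beta+3\}$ or $\alpha\leq 4\beta+7$, then $$1+x_{1n}(\alpha,\beta)<\frac{4(\beta+1)(\beta+2)(\beta+4)}{(5\beta+11)\big[n(n+\alpha+\beta+1)+\frac{1}{2}(\alpha+1)(\beta+1)\big]}.$$
   Context: For $\alpha,\beta>-1$, the Jacobi polynomial of degree $n$ is $$P_n^{(\alpha,\beta)}(x)=\frac{(\alpha+1)_n}{n!}\,{}_2F_1\Big(-n,n+\alpha+\beta+1;\alpha+1;\frac{1-x}{2}\Big)=\frac{(\alpha+1)_n}{n!}\sum_{k=0}^{n}\frac{(-n)_k\,(n+\alpha+\beta+1)_k}{k!\,(\alpha+1)_k}\Big(\frac{1-x}{2}\Big)^k,$$ where $(a)_0=1$ and $(a)_k=a(a+1)\cdots(a+k-1)$. These polynomials are orthogonal on $[-1,1]$ with respect to the weight $(1-x)^{\alpha}(1+x)^{\beta}$. The zeros of $P_n^{(\alpha,\beta)}$ are real, simple and lie in $(-1,1)$; they are denoted $x_{1n}(\alpha,\beta)<x_{2n}(\alpha,\beta)<\cdots<x_{nn}(\alpha,\beta)$. *)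

(* Defs.v *)
From mathcomp Require Import all_boot all_order all_algebra.
From mathcomp Require Import reals.
Set Implicit Arguments.
Unset Strict Implicit.
Unset Printing Implicit Defensive.
Import Order.TTheory GRing.Theory Num.Theory.
Local Open Scope ring_scope.

Definition pochhammer (R : realType) (a : R) (k : nat) : R :=
  \prod_(i < k) (a + i%:R).

(* The sum is the terminating series 2F1(-n, n+alpha+beta+1; alpha+1; (1-X)/2);
   for alpha > -1 no denominator vanishes. *)
Definition jacobi (R : realType) (n : nat) (alpha beta : R) : {poly R} :=
  (pochhammer (alpha + 1) n / (n`!)%:R) *:
  \sum_(k < n.+1)
     ((pochhammer (- n%:R) k * pochhammer (n%:R + alpha + beta + 1) k)
      / ((k`!)%:R * pochhammer (alpha + 1) k))
     *: ((2^-1)%:P * (1 - 'X)) ^+ k.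

Definition smallest_zero (R : realType) (p : {poly R}) (x : R) : Prop :=
  root p x /\ forall y : R, root p y -> x <= y.

(* Main.v *)
Require Import Defs.
From mathcomp Require Import all_boot all_order all_algebra.
From mathcomp Require Import reals.
From mathcomp Require Import ring lra polyrcf.
Set Implicit Arguments.
Unset Strict Implicit.
Unset Printing Implicit Defensive.
Import Order.TTheory GRing.Theory Num.Theory.
Local Open Scope ring_scope.

(** In the variable t = (1+x)/2 the Jacobi polynomial is a multiple of
    F(t) = 2F1(-n, n+a+b-1; b; t), where a = alpha+1 and b = beta+1.  Its n roots
    are simple and lie in (0,1), so F(t) = prod_i (1 - y_i t) with all y_i > 0,
    and t_1 <= (sum_i y_i^3) / (sum_i y_i^4) for the smallest root t_1.  Newton's
    identities turn these two power sums into explicit rational functions of a, b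
    and N = n(n+a+b-1), and the claimed bounds become polynomial inequalities. *)

(** * Pochhammer symbols and the terminating hypergeometric polynomial *)

Lemma pochhammer0 (R : realType) (a : R) : pochhammer a 0 = 1.
Proof. by rewrite /pochhammer big_ord0. Qed.

Lemma pochhammerSr (R : realType) (a : R) k :
  pochhammer a k.+1 = pochhammer a k * (a + k%:R).
Proof. by rewrite /pochhammer big_ord_recr. Qed.

Lemma pochhammerSl (R : realType) (a : R) k :
  pochhammer a k.+1 = a * pochhammer (a + 1) k.
Proof.
rewrite /pochhammer big_ord_recl addr0; congr (_ * _).
by apply: eq_bigr => i _; rewrite -addrA lift0 -natr1 [1 + _]addrC.
Qed.

Lemma pochhammer_gt0 (R : realType) (a : R) k : 0 < a -> 0 < pochhammer a k.
Proof.
by move=> a0; apply: prodr_gt0 => i _; apply: ltr_wpDr => //; rewrite ler0n.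
Qed.

Lemma pochhammer_opp_eq0 (R : realType) n k :
  (n < k)%N -> pochhammer (- n%:R : R) k = 0.
Proof.
by move=> nk; rewrite /pochhammer (bigD1 (Ordinal nk)) //= addNr mul0r.
Qed.

(** Coefficients of 2F1(-n, n+a+b-1; a; t). *)
Definition hypc (R : realType) (n : nat) (a b : R) (k : nat) : R :=
  (pochhammer (- n%:R) k * pochhammer (n%:R + a + b - 1) k)
  / ((k`!)%:R * pochhammer a k).

Definition hyp (R : realType) (n : nat) (a b : R) : {poly R} :=
  \poly_(k < n.+1) hypc n a b k.

(** The truncation at degree [n] loses nothing, since $(-n)_k$ vanishes for $k>n$. *)
Lemma coef_hyp (R : realType) n (a b : R) k : (hyp n a b)`_k = hypc n a b k.
Proof.
rewrite coef_poly; case: ltnP => // nk.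
by rewrite /hypc pochhammer_opp_eq0 ?mul0r.
Qed.

Lemma hyp_at0 (R : realType) n (a b : R) : (hyp n a b).[0] = 1.
Proof.
by rewrite horner_coef0 coef_hyp /hypc !pochhammer0 fact0 !mulr1 divr1.
Qed.

(** * Rodrigues-type recurrence and reflection *)

(** This is [hyp_rodrigues] read off at the coefficient of $t^{k+1}$. *)
Lemma hypc_rec (R : realType) n (a b : R) k : 0 < a ->
  (k.+1%:R + a) * hypc n (a + 1) (b + 1) k.+1 - (k%:R + a + b) * hypc n (a + 1) (b + 1) k
  = a * hypc n.+1 a b k.+1.
Proof.
move=> a0; rewrite /hypc.
have -> : n%:R + (a + 1) + (b + 1) - 1 = n.+1%:R + a + b :> R.
  by rewrite -natr1; ring.
rewrite [pochhammer (- n.+1%:R) _]pochhammerSl.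
rewrite [pochhammer (n.+1%:R + a + b - 1) _]pochhammerSl.
have -> : n.+1%:R + a + b - 1 + 1 = n.+1%:R + a + b :> R by ring.
have -> : - n.+1%:R + 1 = - n%:R :> R by rewrite -natr1; ring.
rewrite [pochhammer a _]pochhammerSl !pochhammerSr factS natrM -!natr1.
have Pn0 : pochhammer (a + 1) k != 0 by rewrite gt_eqF ?pochhammer_gt0 ?addr_gt0.
have k0 : k%:R + 1 != 0 :> R by rewrite natr1 pnatr_eq0.
have fn0 : (k`!)%:R != 0 :> R by rewrite pnatr_eq0 -lt0n fact_gt0.
have an0 : a != 0 by rewrite gt_eqF.
have ak0 : a + 1 + k%:R != 0.
  by rewrite gt_eqF // ltr_wpDr ?ler0n // addr_gt0.
by field; rewrite Pn0 k0 fn0 an0 ak0.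
Qed.

(** One step of Rodrigues' formula, divided by the weight $t^{a-1}(1-t)^{b-1}$: the derivative of
    $t^a(1-t)^b Q$ is $a\,t^{a-1}(1-t)^{b-1}$ times the next polynomial. *)
Lemma hyp_rodrigues (R : realType) n (a b : R) : 0 < a ->
  'X * (1 - 'X) * (hyp n (a + 1) (b + 1))^`()
  + (a *: (1 - 'X) - b *: 'X) * hyp n (a + 1) (b + 1)
  = a *: hyp n.+1 a b.
Proof.
move=> a0; apply/polyP => k; set Q := hyp n _ _.
have -> : 'X * (1 - 'X) * Q^`() + (a *: (1 - 'X) - b *: 'X) * Q
  = Q^`() * 'X - Q^`() * 'X * 'X + a *: Q - (a + b) *: (Q * 'X).
  rewrite -!mul_polyC polyCD; ring.
rewrite !(coefD, coefN, coefZ, coefMX) !coef_deriv !coef_hyp.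
case: k => [|k] /=; first by rewrite /hypc !pochhammer0 fact0; ring.
rewrite -hypc_rec // -[_ *+ k.+1]mulr_natl.
case: k => [|k] /=; first by ring.
by rewrite -[hypc _ _ _ _ *+ _]mulr_natl -!natr1; ring.
Qed.

(* Under t |-> 1 - t, [hyp_rodrigues] goes to its negative with a and b exchanged. *)
Lemma hyp_reflect (R : realType) n (a b : R) : 0 < a -> 0 < b ->
  exists k, hyp n a b = k *: (hyp n b a \Po (1 - 'X)).
Proof.
elim: n a b => [|n IH] a b a0 b0.
  exists 1; rewrite scale1r.
  suff E c d : hyp 0 c d = 1%:P :> {poly R} by rewrite !E comp_polyC.
  apply/polyP => k; rewrite coef_poly coefC; case: k => //=.
  by rewrite /hypc !pochhammer0 fact0 !mulr1 divr1.
have [k E] := IH (a + 1) (b + 1) (addr_gt0 a0 ltr01) (addr_gt0 b0 ltr01).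
have an0 : a != 0 by rewrite gt_eqF.
exists (- k * b / a).
apply: (scalerI an0); rewrite scalerA.
have -> : a * (- k * b / a) = - k * b by field.
rewrite -scalerA -comp_polyZ -hyp_rodrigues // -hyp_rodrigues // E derivZ.
rewrite deriv_comp !(derivB, derivC, derivX) comp_polyD !comp_polyM.
rewrite !comp_polyB !comp_polyZ !comp_polyB !comp_polyX !comp_polyC.
rewrite -!mul_polyC; ring.
Qed.

(** * Sign changes and interlacing *)

Lemma path_lt_last (R : realType) (x : R) l : path <%R x l -> x <= last x l.
Proof.
move/(sub_path (@ltW _ R))/(order_path_min le_trans)/allP => xl.
by have := mem_last x l; rewrite inE => /predU1P[->|/xl].
Qed.

(** The intermediate value theorem gives a root in each open gap; the gaps are disjoint and ordered,
    hence so are the roots. *)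
Lemma sign_change_roots (R : realType) (W : {poly R}) x l :
  path (fun u v => (u < v) && (W.[u] * W.[v] < 0)) x l ->
  exists s, [/\ size s = size l, path <%R x s, all (root W) s &
    all (fun z => z < last x l) s].
Proof.
elim: l x => [|y l IH] x /=; first by exists [::].
case/andP=> /andP[xy W0] /[dup] pl /IH[s [ss ps rs ls]].
have [z /itvP zxy rz] := poly_ivtoo (ltW xy) W0.
exists (z :: s); rewrite /= ss rz rs ls zxy; split=> //.
  case: s ps {ss rs ls} => //= w s /andP[yw ->].
  by rewrite (lt_trans _ yw) ?zxy.
rewrite andbT (lt_le_trans (y := y)) ?zxy //; apply: path_lt_last.
by apply: sub_path pl => u v /andP[].
Qed.

Lemma prod_XsubC_deriv (R : realType) (s1 s2 : seq R) r :
  (\prod_(z <- s1 ++ r :: s2) ('X - z%:P))^`().[r]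
  = \prod_(z <- s1 ++ s2) (r - z).
Proof.
rewrite big_cat big_cons /= mulrCA -big_cat derivM derivXsubC mul1r.
rewrite hornerD hornerM hornerXsubC subrr mul0r addr0.
by rewrite horner_prod; apply: eq_bigr => z _; rewrite hornerXsubC.
Qed.

(** At consecutive roots [r] and [r'] the derivative is a product of differences. Every other root
    lies on the same side of both, so only $r-r'$ against $r'-r$ changes the sign. The prefix [s1]
    lets the induction advance while the product stays fixed. *)
Lemma deriv_alternate (R : realType) (s1 s2 : seq R) r :
  sorted <%R (s1 ++ r :: s2) ->
  forall p, p = (\prod_(z <- s1 ++ r :: s2) ('X - z%:P))^`() ->
  path (fun u v => (u < v) && (p.[u] * p.[v] < 0)) r s2.
Proof.
elim: s2 s1 r => [//|r' s2 IH] s1 r ss p pE /=.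
have [/allrelP s1r /andP[/= rr' rs2] /allP r's2] : [/\
    allrel <%R s1 [:: r, r' & s2], all (> r) (r' :: s2) & all (> r') s2].
  move: ss; rewrite (sorted_pairwise lt_trans) pairwise_cat /=.
  by case/and4P=> -> _ -> /andP[].
have /= := IH (rcons s1 r) r'; rewrite cat_rcons => /(_ ss p pE) ->.
have -> : p.[r] = \prod_(z <- s1 ++ r' :: s2) (r - z).
  by rewrite pE prod_XsubC_deriv.
have -> : p.[r'] = \prod_(z <- s1 ++ r :: s2) (r' - z).
  by rewrite pE -cat_rcons prod_XsubC_deriv cat_rcons.
rewrite rr' andbT !big_cat !big_cons /=.
have pos1 : 0 < \prod_(z <- s1) (r - z) * \prod_(z <- s1) (r' - z).
  rewrite -big_split big_seq prodr_gt0 // => z zs1.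
  by rewrite mulr_gt0 ?subr_gt0 // s1r // !inE eqxx ?orbT.
have pos2 : 0 < \prod_(z <- s2) (r - z) * \prod_(z <- s2) (r' - z).
  rewrite -big_split big_seq prodr_gt0 // => z zs2 /=.
  by rewrite nmulr_rgt0 subr_lt0 ?(allP rs2) ?r's2.
have neg : (r - r') * (r' - r) < 0 by rewrite nmulr_rlt0 ?subr_gt0 ?subr_lt0.
set A := \prod_(z <- s1) _ in pos1 *; set B := \prod_(z <- s1) _ in pos1 *.
set C := \prod_(z <- s2) _ in pos2 *; set D := \prod_(z <- s2) _ in pos2 *.
have -> : A * ((r - r') * C) * (B * ((r' - r) * D))
  = (r - r') * (r' - r) * ((A * B) * (C * D)) by ring.
by rewrite nmulr_rlt0 // mulr_gt0.
Qed.

Lemma interlaced_roots (R : realType) (W : {poly R}) c y l :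
  sorted <%R (y :: l) -> c != 0 ->
  (forall u, u \in y :: l -> exists2 k, 0 < k &
     W.[u] = c * k * (\prod_(z <- y :: l) ('X - z%:P))^`().[u]) ->
  exists s, [/\ size s = size l, path <%R y s, all (root W) s &
    all (fun z => z < last y l) s].
Proof.
move=> yl c0 Wp; apply: sign_change_roots.
apply: (sub_in_path (P := mem (y :: l))) (deriv_alternate (s1 := [::]) yl erefl);
  last exact/allP.
set p := _^`() in Wp *.
move=> u v /= /Wp[k k0 ->] /Wp[k' k'0 ->] /andP[-> puv] /=.
have -> : c * k * p.[u] * (c * k' * p.[v]) = c ^+ 2 * (k * k') * (p.[u] * p.[v]).
  ring.
rewrite pmulr_rlt0 // mulr_gt0 ?(mulr_gt0 k0) //.
by rewrite exprn_even_gt0.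
Qed.

(** * Location of the roots and factorization *)

Lemma poly_with_all_roots (R : realType) (p : {poly R}) s :
  (size p <= (size s).+1)%N -> p != 0 -> all (root p) s -> uniq s ->
  p = lead_coef p *: \prod_(z <- s) ('X - z%:P).
Proof.
move=> sp p0 rs us; apply: all_roots_prod_XsubC; rewrite ?uniq_rootsE //.
by apply/eqP; rewrite eqn_leq sp max_poly_roots.
Qed.

Lemma hyp_neq0 (R : realType) n (a b : R) : hyp n a b != 0.
Proof.
apply/eqP => h0; have := hyp_at0 n a b.
by rewrite h0 horner0 => /eqP; rewrite eq_sym oner_eq0.
Qed.

(* By [hyp_rodrigues], the next polynomial is a positive multiple of
   -c * (t(t-1)M)' at 0, at 1 and at each root of Q = c M, so it changes sign
   between consecutive points of this list. *)
Lemma hyp_roots (R : realType) n (a b : R) : 0 < a -> 0 < b ->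
  exists s, [/\ size s = n, path <%R 0 s, all (root (hyp n a b)) s &
    all (fun z => z < 1) s].
Proof.
elim: n a b => [|n IH] a b a0 b0; first by exists [::].
have [s [ss ps rs s1]] := IH _ _ (addr_gt0 a0 ltr01) (addr_gt0 b0 ltr01).
have := hyp_rodrigues n b a0; move: rs; set Q := hyp n _ _ => rs rodr.
have us : uniq s by apply: (sorted_uniq lt_trans ltxx); exact: path_sorted ps.
have Q0 : Q != 0 := hyp_neq0 _ _ _.
have EQ : Q = lead_coef Q *: \prod_(z <- s) ('X - z%:P).
  by apply: poly_with_all_roots; rewrite // ss size_poly.
set c := lead_coef Q in EQ; set M := \prod_(z <- s) _ in EQ.
have c0 : c != 0 by rewrite lead_coef_eq0.
have Ep : \prod_(z <- 0 :: rcons s 1) ('X - z%:P) = 'X * ('X - 1) * M.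
  by rewrite big_cons -cats1 big_cat big_seq1 /= subr0 -/M; ring.
have [||u|t [ts pt rt lt]] :=
  @interlaced_roots _ (a *: hyp n.+1 a b) (- c) 0 (rcons s 1).
- rewrite /= rcons_path ps /=.
  by have := mem_last 0 s; rewrite inE => /predU1P[->//|/(allP s1)].
- by rewrite oppr_eq0.
- rewrite Ep -rodr EQ derivZ !derivM derivB derivX derivC.
  rewrite inE mem_rcons inE => /or3P[/eqP->|/eqP->|us'].
  + by exists a => //; rewrite !hornerE /=; ring.
  + by exists b => //; rewrite !hornerE /=; ring.
  + have Mu : M.[u] = 0 by apply/rootP; rewrite root_prod_XsubC.
    by exists 1 => //; rewrite !hornerE Mu /=; ring.
exists t; rewrite ts size_rcons ss pt; split=> //.
  apply: sub_all rt => z; rewrite rootZ // gt_eqF //.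
by move: lt; rewrite last_rcons.
Qed.

Lemma hyp_factor (R : realType) n (a b : R) s :
  size s = n -> path <%R 0 s -> all (root (hyp n a b)) s ->
  hyp n a b = \prod_(y <- [seq z^-1 | z <- s]) (1 - y *: 'X).
Proof.
move=> ss ps rs.
have us : uniq s by apply: (sorted_uniq lt_trans ltxx); exact: path_sorted ps.
have s0 z : z \in s -> 0 < z by exact: (allP (order_path_min lt_trans ps)).
have EQ : hyp n a b = lead_coef (hyp n a b) *: \prod_(z <- s) ('X - z%:P).
  by apply: poly_with_all_roots; rewrite ?hyp_neq0 // ss size_poly.
have := hyp_at0 n a b; rewrite EQ hornerZ horner_prod.
under eq_bigr => z _ do rewrite hornerXsubC sub0r.
set c := lead_coef _ => E.
(* The value 1 at 0 determines the leading coefficient. *)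
have -> : c = \prod_(z <- s) (- z)^-1.
  have P0 : \prod_(z <- s) (- z) != 0.
    by apply/eqP => P0; move/eqP: E; rewrite P0 mulr0 eq_sym oner_eq0.
  by rewrite prodfV; apply: (mulIf P0); rewrite mulVf.
rewrite big_map -scaler_prod big_seq [RHS]big_seq; apply: eq_bigr => z /s0 z0.
by rewrite invrN scaleNr scalerBr opprB -mul_polyC -polyCM mulVf ?gt_eqF.
Qed.

(** * Power sums of the inverse roots *)

Lemma newton_sums (R : realType) (s : seq R) :
  let q := \prod_(y <- s) (1 - y *: 'X) in
  [/\ q`_0 = 1, \sum_(y <- s) y = - q`_1,
   \sum_(y <- s) y ^+ 2 = q`_1 ^+ 2 - 2 * q`_2,
   \sum_(y <- s) y ^+ 3 = - q`_1 ^+ 3 + 3 * q`_1 * q`_2 - 3 * q`_3 &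
   \sum_(y <- s) y ^+ 4 = q`_1 ^+ 4 - 4 * q`_1 ^+ 2 * q`_2 + 2 * q`_2 ^+ 2
      + 4 * q`_1 * q`_3 - 4 * q`_4].
Proof.
elim: s => [|y s] /=.
  by rewrite !big_nil !coefE /=; split=> //; ring.
rewrite !big_cons; set q := \prod_(y <- s) _; case=> e0 e1 e2 e3 e4.
have E k : ((1 - y *: 'X) * q)`_k.+1 = q`_k.+1 - y * q`_k.
  by rewrite mulrBl mul1r -scalerAl coefB coefZ coefXM.
rewrite !E e1 e2 e3 e4 e0 mulrBl mul1r -scalerAl coefB coefZ coefXM /= e0.
by split; ring.
Qed.

(** Termwise: $t \le z$ and $y = 1/z > 0$ give $ty \le 1$, hence $t y^4 \le y^3$. *)
Lemma root_rayleigh_bound (R : realType) (s : seq R) t :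
  path <%R 0 s -> (forall z, z \in s -> t <= z) ->
  let ys := [seq z^-1 | z <- s] in
  t * (\sum_(y <- ys) y ^+ 4) <= \sum_(y <- ys) y ^+ 3.
Proof.
move=> ps ts /=; rewrite !big_map mulr_sumr.
rewrite big_seq [leRHS]big_seq ler_sum // => z zs.
have z0 : 0 < z by exact: (allP (order_path_min lt_trans ps)).
have tz : t / z <= 1 by rewrite ler_pdivrMr // mul1r ts.
by rewrite exprS mulrA ler_piMl // exprn_ge0 // invr_ge0 ltW.
Qed.

(** Since $(k-n)(n+a+b-1+k) = -(N - k(a+b-1+k))$, the coefficients depend on [n] only through $N =
    n(n+a+b-1)$. *)
Lemma hypcS (R : realType) n (a b : R) k : 0 < a ->
  hypc n a b k.+1 = - hypc n a b k
    * (n%:R * (n%:R + a + b - 1) - k%:R * (a + b - 1 + k%:R)) / (k.+1%:R * (a + k%:R)).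
Proof.
move=> a0; rewrite /hypc !pochhammerSr factS natrM -[k.+1%:R]natr1.
have Pn0 : pochhammer a k != 0 by rewrite gt_eqF ?pochhammer_gt0.
have k0 : k%:R + 1 != 0 :> R by rewrite natr1 pnatr_eq0.
have fn0 : (k`!)%:R != 0 :> R by rewrite pnatr_eq0 -lt0n fact_gt0.
have ak0 : a + k%:R != 0 by rewrite gt_eqF // ltr_wpDr ?ler0n.
by field; rewrite Pn0 k0 fn0 ak0.
Qed.

(** * Polynomial inequalities between the two power sums *)

(** The third and fourth power sums of the inverses of the roots are
    N rayleigh3 / (b^3 (b+1) (b+2)) and N rayleigh4 / (b^4 (b+1)^2 (b+2) (b+3)). *)
Definition rayleigh3 (R : realType) (N a b : R) : R :=
  2 * N ^+ 2 + N * b * (3 * a + 2 * b) + b ^+ 2 * (a + b) * (a + b + 1).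

Definition rayleigh4 (R : realType) (N a b : R) : R :=
  N ^+ 3 * (5 * b + 6) + 2 * N ^+ 2 * b * (5 * a * b + 6 * a + 3 * b ^+ 2 + 4 * b)
  + N * b ^+ 2 * (a ^+ 2 * (6 * b + 7) + a * (9 * b ^+ 2 + 15 * b + 4)
      + b * (3 * b ^+ 2 + 6 * b + 2))
  + b ^+ 3 * (b + 1) * (a + b) * (a + b + 1) * (a + b + 2).

Lemma rayleigh3_gt0 (R : realType) (N a b : R) :
  0 < a -> 0 < b -> 4 * (a + b + 3) <= N ->
  0 < rayleigh3 N a b.
Proof.
move=> a0 b0 N0.
have N1 : 0 < N by lra.
by rewrite /rayleigh3; do ?[done | apply: addr_gt0 | apply: mulr_gt0 | apply: exprn_gt0].
Qed.

Lemma rayleigh_third (R : realType) (N a b : R) :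
  0 < a -> 0 < b -> 4 * (a + b + 3) <= N ->
  (5 * b + 6) * (N + 1 / 3 * (a * b)) * rayleigh3 N a b < 2 * rayleigh4 N a b.
Proof.
move=> a0 b0 N0.
have N1 : 0 < N by lra.
rewrite -subr_gt0.
have -> : 2 * rayleigh4 N a b - (5 * b + 6) * (N + 1 / 3 * (a * b)) * rayleigh3 N a b
  = b / 3 * (N * b * (6 * N * b + 12 * N - 6 * b) +
  N ^+ 2 * a * (5 * b + 6) + N * b * (6 * a ^+ 2 * (b + 1)
    + a * (14 * b ^+ 2 + 27 * b + 6) + 3 * b ^+ 3 + 3 * b ^+ 2)
  + b ^+ 2 * (a ^+ 3 * b + a ^+ 2 * (8 * b ^+ 2 + 19 * b + 12)
     + a * (13 * b ^+ 3 + 43 * b ^+ 2 + 42 * b + 12) + 6 * b * (b + 1) ^+ 2 * (b + 2))).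
  by rewrite /rayleigh3 /rayleigh4; field.
(* This bracket holds the only negative term of the expansion; it equals $6b(N-1)+12N$, and
   $N>12$. *)
have ? : 0 < 6 * N * b + 12 * N - 6 * b by nra.
by do ?[done | apply: divr_gt0 | apply: addr_gt0 | apply: mulr_gt0 | apply: exprn_gt0].
Qed.

Lemma rayleigh_half (R : realType) (N a b : R) :
  0 < a -> 0 < b -> 4 * (a + b + 3) <= N ->
  a <= 4 * b + 4 \/ 2 * (a + b) * (a + b + 1) <= N ->
  (5 * b + 6) * (N + 1 / 2 * (a * b)) * rayleigh3 N a b < 2 * rayleigh4 N a b.
Proof.
move=> a0 b0 N0.
have N1 : 0 < N by lra.
move=> H; rewrite -subr_gt0.
have -> : 2 * rayleigh4 N a b - (5 * b + 6) * (N + 1 / 2 * (a * b)) * rayleigh3 N a b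
  = b ^+ 2 * (b + 2) / 2 * (N * (4 * N - a ^+ 2 + 6 * a * b + 2 * a
      + 2 * b ^+ 2 - 2 * b) + b * (4 * b + 4 - a) * ((a + b) * (a + b + 1))).
  by rewrite /rayleigh3 /rayleigh4; field.
rewrite pmulr_rgt0; last by rewrite ?(divr_gt0, mulr_gt0, exprn_gt0, addr_gt0).
have ab0 : 0 < a * b by rewrite mulr_gt0.
have b20 : 0 < b ^+ 2 by rewrite exprn_gt0.
(* If $a \le 4b+4$, the last summand is nonnegative, and $a^2 \le (4b+4)a$ with $N \ge 4(a+b+3)$
   makes the factor of [N] positive. *)
case: H => H.
  apply: ltr_wpDr.
    by rewrite !mulr_ge0 ?subr_ge0 ?addr_ge0 ?(ltW a0) ?(ltW b0).
  rewrite mulr_gt0 //.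
  have : a * a <= (4 * b + 4) * a by rewrite ler_pM2r.
  lra.
(* Otherwise the negative part $-ab(a+b)(a+b+1)$ is at least $-Nab/2$. One of the six copies of
   $Nab$ absorbs it, and $4N$ alone outweighs $a^2+2b$ in what remains. *)
have : 0 <= a * b * (N - 2 * ((a + b) * (a + b + 1))).
  by rewrite mulr_ge0 ?subr_ge0 ?mulrA // ltW.
have : 0 < b * (4 * b + 4) * ((a + b) * (a + b + 1)).
  by rewrite ?(mulr_gt0, addr_gt0).
have : 0 < N * (4 * N - a ^+ 2 + 5 * a * b + 2 * a + 2 * b ^+ 2 - 2 * b).
  rewrite mulr_gt0 //; have : 0 < a ^+ 2 by rewrite exprn_gt0.
  lra.
have : 0 < N * (a * b) by rewrite mulr_gt0.
lra.
Qed.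

(** * From power sums to the smallest zero *)

Lemma hyp_smallest_root (R : realType) n (a b t : R) : 0 < a -> 0 < b -> (0 < n)%N ->
  (forall z, root (hyp n b a) z -> t <= z) ->
  forall N, N = n%:R * (n%:R + a + b - 1) ->
  t * rayleigh4 N a b <= b * (b + 1) * (b + 3) * rayleigh3 N a b.
Proof.
move=> a0 b0 n0 ht N NE.
have n1 : 1 <= n%:R :> R by rewrite ler1n.
have N0 : 0 < N by rewrite NE mulr_gt0 //; lra.
have [s [ss ps rs _]] := hyp_roots n b0 a0.
have := root_rayleigh_bound ps (fun z zs => ht z (allP rs z zs)).
have := newton_sums [seq z^-1 | z <- s].
rewrite -(hyp_factor ss ps rs) /= !coef_hyp => -[_ _ _ -> ->].
rewrite !hypcS // /hypc !pochhammer0 fact0.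
have -> : n%:R * (n%:R + b + a - 1) = N by rewrite NE; ring.
have bn k : b + k%:R != 0 by rewrite gt_eqF // ltr_wpDr ?ler0n.
set L := (X in t * X <= _ -> _); set S := (X in _ <= X -> _).
have b1 : b + 1 != 0 := bn 1.
have b2 : b + 2 != 0 := bn 2.
have b3 : b + 3 != 0 := bn 3.
have b4 : b != 0 by rewrite gt_eqF.
(* Both power sums are written with the same positive factor, which then cancels. *)
have EL : L = N / (b ^+ 4 * (b + 1) ^+ 2 * (b + 2) * (b + 3)) * rayleigh4 N a b.
  by rewrite /L /rayleigh4; field; rewrite b1 b2 b3 b4.
have ES : S = N / (b ^+ 4 * (b + 1) ^+ 2 * (b + 2) * (b + 3))
    * (b * (b + 1) * (b + 3) * rayleigh3 N a b).
  by rewrite /S /rayleigh3; field; rewrite b1 b2 b3 b4.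
rewrite EL ES mulrCA ler_pM2l //; apply: divr_gt0 => //.
by rewrite ?(mulr_gt0, exprn_gt0, addr_gt0).
Qed.

Lemma jacobi_hyp (R : realType) n (alpha beta x : R) :
  (jacobi n alpha beta).[x] = pochhammer (alpha + 1) n / (n`!)%:R
    * (hyp n (alpha + 1) (beta + 1)).[(1 - x) / 2].
Proof.
rewrite /jacobi hornerZ horner_sum horner_poly; congr (_ * _).
apply: eq_bigr => k _; rewrite hornerZ horner_exp !hornerE /hypc.
have -> : n%:R + (alpha + 1) + (beta + 1) - 1 = n%:R + alpha + beta + 1 by ring.
by rewrite [2^-1 * _]mulrC.
Qed.

(** By reflection, a root [z] of the polynomial with swapped parameters gives the Jacobi zero
    $2z-1$, because $(1-(2z-1))/2 = 1-z$. *)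
Lemma jacobi_smallest_root (R : realType) n (alpha beta x z : R) :
  -1 < alpha -> -1 < beta -> smallest_zero (jacobi n alpha beta) x ->
  root (hyp n (beta + 1) (alpha + 1)) z -> (1 + x) / 2 <= z.
Proof.
move=> ha hb [_ hx] /rootP rz.
have a0 : 0 < alpha + 1 by lra.
have b0 : 0 < beta + 1 by lra.
have [k E] := hyp_reflect n a0 b0.
suff /hx : root (jacobi n alpha beta) (2 * z - 1) by lra.
apply/rootP; rewrite jacobi_hyp E hornerZ horner_comp !hornerE /=.
have -> : 1 - (1 - (2 * z - 1)) / 2 = z by field.
by rewrite rz !mulr0.
Qed.

Lemma ratio_bound (R : realFieldType) (K B t u v : R) :
  0 < K -> 0 < B -> 0 < u -> K * u < 2 * v -> t * v <= B * u ->
  2 * t < 4 * B / K.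
Proof.
move=> K0 B0 u0 uv tuv; rewrite ltr_pdivlMr //.
(* Multiplying $Ku<2v$ by [t] needs $t>0$; for $t \le 0$ the right side is already larger by
   sign. *)
have [t0|t0] := lerP t 0.
  apply: (@le_lt_trans _ _ 0); last by rewrite mulr_gt0.
  by rewrite pmulr_lle0 // pmulr_rle0.
rewrite -(ltr_pM2r u0).
have : t * (K * u) < t * (2 * v) by rewrite ltr_pM2l.
lra.
Qed.

Theorem theorem2 (R : realType) (n : nat) (alpha beta x1n : R)
    (hn : (4 <= n)%N) (halpha : -1 < alpha) (hbeta : -1 < beta)
    (hx : smallest_zero (jacobi n alpha beta) x1n) :
  1 + x1n <
    (4 * (beta + 1) * (beta + 2) * (beta + 4)) /
    ((5 * beta + 11) *
     (n%:R * (n%:R + alpha + beta + 1)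
      + 1 / 3 * ((alpha + 1) * (beta + 1))))
  /\
  (Num.max 4 (alpha + beta + 3) <= n%:R \/ alpha <= 4 * beta + 7 ->
   1 + x1n <
    (4 * (beta + 1) * (beta + 2) * (beta + 4)) /
    ((5 * beta + 11) *
     (n%:R * (n%:R + alpha + beta + 1)
      + 1 / 2 * ((alpha + 1) * (beta + 1))))).
Proof.
set a := alpha + 1; set b := beta + 1; set N := n%:R * _.
have a0 : 0 < a by rewrite /a; lra.
have b0 : 0 < b by rewrite /b; lra.
have n4 : 4 <= n%:R :> R by rewrite (ler_nat R 4).
have NE : N = n%:R * (n%:R + a + b - 1) by rewrite /N /a /b; ring.
have N4 : 4 * (a + b + 3) <= N.
  rewrite -subr_ge0.
  (* The bound $4(a+b+3)$ is the value of [N] at $n=4$, hence the factor $n-4$. *)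
  have -> : N - 4 * (a + b + 3) = (n%:R - 4) * (n%:R + a + b + 3).
    by rewrite NE; ring.
  by rewrite mulr_ge0; lra.
have tb := hyp_smallest_root a0 b0 (leq_trans (isT : (0 < 4)%N) hn)
  (fun z => @jacobi_smallest_root _ n _ _ _ z halpha hbeta hx) NE.
(* Both estimates follow from one argument, with $c=1/3$ and $c=1/2$. *)
have bound c : 0 < c ->
    (5 * b + 6) * (N + c * (a * b)) * rayleigh3 N a b < 2 * rayleigh4 N a b ->
    1 + x1n < (4 * b * (beta + 2) * (beta + 4)) /
      ((5 * beta + 11) * (N + c * (a * b))).
  move=> c0 hc.
  have K0 : 0 < (5 * b + 6) * (N + c * (a * b)).
    have : 0 < c * (a * b) by rewrite !mulr_gt0.
    by move=> ?; rewrite mulr_gt0; lra.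
  have B0 : 0 < b * (b + 1) * (b + 3) by rewrite !mulr_gt0; lra.
  have := ratio_bound K0 B0 (rayleigh3_gt0 a0 b0 N4) hc tb.
  have -> : 2 * ((1 + x1n) / 2) = 1 + x1n by field.
  have -> : 5 * beta + 11 = 5 * b + 6 by rewrite /b; ring.
  have -> : beta + 2 = b + 1 by rewrite /b; ring.
  have -> : beta + 4 = b + 3 by rewrite /b; ring.
  by rewrite !mulrA.
split; first by apply: bound; [lra|exact: rayleigh_third].
move=> H; apply: bound; first by lra.
apply: rayleigh_half => //.
case: H => [|H]; last by left; rewrite /a /b; lra.
rewrite ge_max => /andP[_ nab]; right.
(* From $n \ge a+b+1$ also $n+a+b-1 \ge 2(a+b)$; multiplying the two gives $N \ge 2(a+b)(a+b+1)$. *)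
have nab' : a + b + 1 <= n%:R by rewrite /a /b; lra.
rewrite NE mulrC; apply: ler_pM; lra.
Qed.
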